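(* Let $c>0$ be a constant. Almost surely, all rigid components in $\mathbb{G}(n,c/n)$ span $2$, $3$, or $\Omega(n)$ vertices; that is, there is a constant $\alpha=\alpha(c)>0$, independent of $n$, such that the probability that every rigid component of $\mathbb{G}(n,c/n)$ has exactly $2$ vertices, exactly $3$ vertices, or at least $\alpha n$ vertices tends to $1$ as $n\to\infty$. Moreover, if $c>4$, then almost surely there are rigid components of size at least $n/10$; that is, the probability that $\mathbb{G}(n,c/n)$ has a rigid component with at least $n/10$ vertices tends to $1$ as $n\to\infty$.
   Context: $\mathbb{G}(n,p)$ is the Erdős–Rényi random graph: a simple graph on $n$ labeled vertices in which each of the $\binom n2$ possible edges is included independently with probability $p$. Here $p=c/n$ with $c$ fixed and $n$ large enough that $c/n\le 1$. A property holds almost surely if the probability that the random graph has it tends to $1$ as $n\to\infty$. A graph on $n\ge 2$ vertices is $(2,3)$-sparse if every subgraph induced by $n'\ge 2$ of its vertices has at most $2n'-3$ edges. A $(2,3)$-sparse graph with exactly $2n-3$ edges is called a Laman graph. A graph is rigid if it contains a spanning Laman subgraph (a Laman graph on all of its vertices). For a simple graph $G$, a block of $G$ is a rigid induced subgraph of $G$ (on at least $2$ vertices), and a rigid component of $G$ is a block that is inclusion-wise maximal among the blocks of $G$. In particular a single edge is a rigid graph on $2$ vertices, and a triangle is a rigid graph on $3$ vertices. The size of a component is its number of vertices. *)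

(* Defs.v *)
From HB Require Import structures.
From mathcomp Require Import all_boot all_order all_algebra.
From mathcomp Require Import all_classical all_reals all_analysis.
Set Implicit Arguments.
Unset Strict Implicit.
Unset Printing Implicit Defensive.
Import Order.TTheory GRing.Theory Num.Theory.
Import numFieldNormedType.Exports.
Local Open Scope ring_scope.
Local Open Scope classical_set_scope.

(* A simple graph is a pair (W, E): a vertex set W inside an ambient finite
   type V, and an edge set E made of two-element subsets of W. *)
Section Rigidity.
Variable V : finType.
Implicit Types (W : {set V}) (E : {set {set V}}).

Definition vpairs W : {set {set V}} :=
  [set e : {set V} | (e \subset W) && (#|e| == 2%N)].

Definition induced_edges E W : {set {set V}} := [set e in E | e \subset W].

(* The truncated subtraction is harmless: it is only used for n' >= 2. *)
Definition sparse23 W E : bool :=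
  (2 <= #|W|)%N &&
  [forall W' : {set V}, (W' \subset W) && (2 <= #|W'|)%N ==>
     (#|induced_edges E W'| <= 2 * #|W'| - 3)%N].

Definition laman W E : bool :=
  sparse23 W E && (#|E| == (2 * #|W| - 3)%N).

Definition rigid W E : bool :=
  [exists L : {set {set V}},
     [&& L \subset E, L \subset vpairs W & laman W L]].

Definition block E W : bool := (2 <= #|W|)%N && rigid W (induced_edges E W).

Definition rigid_component E W : bool := maxset (block E) W.

End Rigidity.

Section RandomGraph.
Variable R : realType.

Definition complete_edges n : {set {set 'I_n}} := vpairs [set: 'I_n]%SET.

(* Each potential edge is present independently with probability p. *)
Definition gnp_weight n (p : R) (E : {set {set 'I_n}}) : R :=
  \prod_(e in complete_edges n) (if e \in E then p else 1 - p).

(* This is the law of G(n,p) when 0 <= p <= 1; for p = c / n the finitely many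
   other n do not affect limits. *)
Definition gnp_prob n (p : R) (A : pred {set {set 'I_n}}) : R :=
  \sum_(E : {set {set 'I_n}} | (E \subset complete_edges n) && A E)
     gnp_weight p E.

Definition almost_surely (c : R) (A : forall n, pred {set {set 'I_n}}) : Prop :=
  gnp_prob (c / n%:R) (A n) @[n --> \oo] --> (1 : R).

End RandomGraph.

(* Main.v *)
(* First moment.  A rigid component W on k vertices spans at least 2k-3 edges,
   and every vertex outside W has at most one neighbour in W, since a second one
   would enlarge W by a Henneberg move.  With p = c/n and x = k/n, exponential
   tilting of the edge count of W by t = 1/x bounds the expected number of such W.
   For all c the bound is at most B^k x^(k-3) with B = e^(1+c/2), which is
   summable to O(1/n) over 4 <= k <= n/(2B).  For c slightly above 4 it is
   exp(n F(x)) up to a factor O(x^-3), where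
     F(x) = x ln x + (1-x) (ln ((1+cx)/(1-x)) - cx/2) <= -x/20  for x <= 1/10;
   the constraint on the outside vertices is what makes this hold up to x = 1/10.
   If c > 4, there are more than 2n edges almost surely, so some minimal vertex
   set violates sparsity; it is rigid and has at least 4 vertices, and the
   component containing it must have at least n/10 vertices.  Larger c reduces to
   c <= 81/20 by monotonicity. *)
Require Import Defs.
From HB Require Import structures.
From mathcomp Require Import all_boot all_order all_algebra.
From mathcomp Require Import all_classical all_reals all_analysis.
From mathcomp Require Import ring lra zify.
Import fintype boot.finset.
Set Implicit Arguments.
Unset Strict Implicit.
Unset Printing Implicit Defensive.
Import Order.TTheory GRing.Theory Num.Theory.
Import numFieldNormedType.Exports.
Local Open Scope ring_scope.

(** * Rigid blocks: vertex additions and violations of sparsity *)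

Section Blocks.
Variable V : finType.
Implicit Types (W : {set V}) (E L : {set {set V}}).

Lemma card_vpairs W : #|vpairs W| = 'C(#|W|, 2).
Proof. exact: cards_draws. Qed.

Lemma induced_edgesS E E' W W' :
  E \subset E' -> W \subset W' -> induced_edges E W \subset induced_edges E' W'.
Proof.
move=> sE sW; apply/subsetP => e; rewrite !inE => /andP[eE eW].
by rewrite (subsetP sE) // (subset_trans eW).
Qed.

Lemma induced_edges_vpairs E W :
  E \subset vpairs [set: V] -> induced_edges E W \subset vpairs W.
Proof.
move=> sE; apply/subsetP => e; rewrite !inE => /andP[/(subsetP sE) + ->].
by rewrite !inE => /andP[].
Qed.

Lemma card_induced_vpairs E W :
  E \subset vpairs [set: V] -> (#|induced_edges E W| <= 'C(#|W|, 2))%N.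
Proof.
by move=> sE; rewrite -card_vpairs subset_leq_card // induced_edges_vpairs.
Qed.

Lemma blockW E W L : (2 <= #|W|)%N -> L \subset induced_edges E W ->
  L \subset vpairs W -> sparse23 W L -> #|L| = (2 * #|W| - 3)%N -> block E W.
Proof.
move=> W2 LE LW sp cL; rewrite /block W2; apply/existsP; exists L.
by rewrite LE LW /laman sp cL eqxx.
Qed.

Lemma blockP E W : block E W ->
  [/\ (2 <= #|W|)%N & exists L, [/\ L \subset induced_edges E W,
    L \subset vpairs W, sparse23 W L & #|L| = (2 * #|W| - 3)%N]].
Proof.
case/andP=> W2 /existsP[L /and3P[LE LW /andP[sp /eqP cL]]].
by split=> //; exists L.
Qed.

Lemma blockS E E' W : E \subset E' -> block E W -> block E' W.
Proof.
move=> sE /blockP[W2 [L [LE LW sp cL]]]; apply: (blockW W2 _ LW sp cL).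
exact: subset_trans LE (induced_edgesS sE (subxx W)).
Qed.

Lemma block_induced_edges E W :
  block E W -> (2 * #|W| - 3 <= #|induced_edges E W|)%N.
Proof. by case/blockP=> _ [L [LE _ _ <-]]; apply: subset_leq_card. Qed.

(* Henneberg's first move. *)
Lemma block_add_vertex E W v a b : block E W -> v \notin W ->
  a \in W -> b \in W -> a != b -> [set v; a] \in E -> [set v; b] \in E ->
  block E (v |: W).
Proof.
have ar x y m : (x <= y.+2 -> 2 <= m -> y <= 2 * m - 3 -> x <= 2 * m.+1 - 3)%N.
  by lia.
have ar2 m : (2 <= m -> (2 * m - 3).+2 = 2 * m.+1 - 3)%N by lia.
move=> /blockP[W2 [L [LE LW /andP[_ /forallP sp] cL]]] vW aW bW ab vaE vbE.
have va : v != a by apply: contraNneq vW => ->.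
have vb : v != b by apply: contraNneq vW => ->.
have dva : [set v; a] != [set v; b].
  apply: contraNneq ab => /setP/(_ a); rewrite !inE eqxx orbT.
  by move/esym/orP=> [/eqP av|//]; rewrite av eqxx in va.
have vL (e : {set V}) : v \in e -> e \notin L.
  move=> ve; apply: contra vW => /(subsetP LW); rewrite inE => /andP[eW _].
  exact: (subsetP eW).
set L' := ([set v; a] |: ([set v; b] |: L)).
have cL' : #|L'| = #|L|.+2.
  by rewrite !cardsU1 !inE negb_or dva !vL ?inE ?eqxx.
have sL' : L' \subset vpairs (v |: W).
  apply/subsetP => e; rewrite !inE => /or3P[/eqP->|/eqP->|/(subsetP LW)].
  - rewrite cards2 va andbT; apply/subsetP => z; rewrite !inE.
    by case/orP=> /eqP->; rewrite ?eqxx ?aW ?orbT.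
  - rewrite cards2 vb andbT; apply/subsetP => z; rewrite !inE.
    by case/orP=> /eqP->; rewrite ?eqxx ?bW ?orbT.
  - rewrite inE => /andP[eW ->]; rewrite andbT.
    by apply: (subset_trans eW); rewrite subsetUr.
have cW : #|v |: W| = #|W|.+1 by rewrite cardsU1 vW.
apply: (@blockW _ _ L') => //.
- by rewrite cW (leqW W2).
- apply/subsetP => e eL'; have := subsetP sL' _ eL'; rewrite inE => /andP[eW _].
  rewrite inE eW andbT; move: eL'; rewrite !inE.
  case/or3P=> [/eqP->|/eqP->|/(subsetP LE)]//.
  by rewrite inE => /andP[].
- apply/andP; split; first by rewrite cW (leqW W2).
  apply/forallP => X; apply/implyP => /andP[XW X2].
  (* A set avoiding [v] sees only edges of [L]. Removing [v] from a set containing it loses at most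
     the two new edges, which is the drop of the sparsity bound as long as two vertices remain. *)
  have [vX|vX] := boolP (v \in X); last first.
    have XW' : X \subset W.
      apply/subsetP => z zX; have := subsetP XW _ zX; rewrite !inE.
      by case/orP=> // /eqP zv; rewrite -zv zX in vX.
    have := sp X; rewrite XW' X2 /=; apply: leq_trans; apply: subset_leq_card.
    apply/subsetP => e; rewrite !inE => /andP[+ eX]; rewrite eX andbT.
    have ve (u : V) : e != [set v; u].
      apply: contraNneq vX => ee; apply: (subsetP eX).
      by rewrite ee !inE eqxx.
    by rewrite (negPf (ve a)) (negPf (ve b)).
  set Y := (X :\ v).
  have YW : Y \subset W.
    apply/subsetP => z; rewrite !inE => /andP[zv /(subsetP XW)].
    by rewrite !inE (negPf zv).
  have cX : #|X| = #|Y|.+1 by rewrite (cardsD1 v) vX.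
  have [Y2|Y1] := leqP 2 #|Y|.
    have : (#|induced_edges L' X| <= #|induced_edges L Y|.+2)%N.
      apply: (@leq_trans #|([set v; a] |: ([set v; b] |: induced_edges L Y))|).
        apply: subset_leq_card; apply/subsetP => e; rewrite !inE.
        case/andP=> /or3P[->|->|eL] eX; rewrite ?orbT//.
        rewrite eL subsetD1 eX (contraL (@vL e) eL) ?orbT //.
      rewrite !cardsU1 addnA -addn2 addnC leq_add2l.
      by case: (_ \notin _); case: (_ \notin _).
    move=> /ar; rewrite cX; apply=> //.
    by have := sp Y; rewrite YW Y2.
  (* Here [X] is a pair, and the bound [2 * 2 - 3] equals ['C(2, 2)]. *)
  have cX2 : #|X| = 2 by apply/eqP; rewrite eqn_leq X2 cX ltnS -ltnS Y1.
  rewrite cX2; have := @card_induced_vpairs L' X.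
  rewrite cX2 => -> //; apply/subsetP => e /(subsetP sL').
  by rewrite !inE => /andP[_ ->]; rewrite subsetT.
- by rewrite cL' cL cW ar2.
Qed.

Lemma rigid_component_block E W : rigid_component E W -> block E W.
Proof. by case/maxsetP. Qed.

Lemma rigid_component_nbr E W v a b : rigid_component E W -> v \notin W ->
  a \in W -> b \in W -> [set v; a] \in E -> [set v; b] \in E -> a = b.
Proof.
case/maxsetP=> bW maxW vW aW bbW vaE vbE; apply/eqP; apply: contraNT (vW) => ab.
rewrite -(maxW _ (block_add_vertex bW vW aW bbW ab vaE vbE)) ?setU11//.
exact: subsetUr.
Qed.

(* An inclusion-minimal vertex set violating sparsity is a block. *)
Lemma dense_block E : E \subset vpairs [set: V] -> (2 <= #|V|)%N ->
  (2 * #|V| - 2 <= #|E|)%N -> exists2 W, block E W & (4 <= #|W|)%N.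
Proof.
move=> sE V2 dE.
pose viol W := (2 <= #|W|)%N && (2 * #|W| - 2 <= #|induced_edges E W|)%N.
have [|W /minsetP[/andP[W2 dW] minW]] := @ex_minset _ viol.
  exists [set: V]; rewrite /viol cardsT V2.
  have -> // : induced_edges E [set: V] = E.
  by apply/setP => e; rewrite inE subsetT andbT.
have iW : induced_edges E W \subset vpairs W by exact: induced_edges_vpairs.
exists W; last first.
  (* A violation needs 2 edges on two vertices or 4 edges on three, more than the 1 or 3 available
     pairs. *)
  have := card_induced_vpairs W sE; case: #|W| W2 dW => [|[|[|[|]]]] //=.
  - by move=> _ + +; rewrite binn; lia.
  - by move=> _ + +; rewrite (_ : 'C(3, 2) = 3) //; lia.
(* Any [2 * #|W| - 3] induced edges form a Laman graph: proper subsets of [W] do not violate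
   sparsity by minimality, and on [W] itself the count is exact by choice. *)
have [s us [ss sl]] : exists2 s : seq {set V}, uniq s &
    {subset s <= induced_edges E W} /\ size s = (2 * #|W| - 3)%N.
  exists (take (2 * #|W| - 3) (enum (induced_edges E W))).
    by rewrite take_uniq // enum_uniq.
  split; first by move=> e /mem_take; rewrite mem_enum.
  by rewrite size_takel // -cardE (leq_trans _ dW) // leq_sub2l.
have sL : [set e in s] \subset induced_edges E W.
  by apply/subsetP => e; rewrite inE => /ss.
have cL : #|[set e in s]| = (2 * #|W| - 3)%N.
  by rewrite cardsE (card_uniqP us).
apply: (blockW W2 sL (subset_trans sL iW)) => //.
apply/andP; split=> //; apply/forallP => X; apply/implyP => /andP[XW X2].
have [->|XnW] := eqVneq X W.
  rewrite -cL; apply: subset_leq_card; apply/subsetP => e; rewrite inE.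
  by case/andP.
have : ~~ viol X by apply: contra XnW => vX; rewrite (minW _ vX XW).
have ar k m : (k < 2 * m - 2 -> k <= 2 * m - 3)%N by lia.
rewrite /viol X2 /= -ltnNge => /ar; apply: leq_trans.
apply/subset_leq_card/induced_edgesS => //.
by apply: (subset_trans sL); apply/subsetP => e; rewrite inE => /andP[].
Qed.

Lemma block_component E W : block E W ->
  exists2 W', rigid_component E W' & W \subset W'.
Proof. by case/maxset_exists => W' mW' sW; exists W'. Qed.

End Blocks.

(** * Sums over subsets of products over elements *)

Section SubsetSums.
Variables (R : comNzRingType) (T : finType).
Implicit Types (D P : {set T}) (F G : T -> R).

Lemma sum_subset_prod D F G :
  \sum_(E : {set T} | E \subset D)
     \prod_(e in D) (if e \in E then F e else G e) =
  \prod_(e in D) (F e + G e).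
Proof.
(* Outside [D] a chosen element gets factor 0 and an omitted one factor 1, so only subsets of [D]
   survive the expansion. *)
transitivity (\prod_e ((if e \in D then F e else 0) +
                       (if e \in D then G e else 1))); last first.
  rewrite [RHS]big_mkcond; apply: eq_bigr => e _.
  by case: ifP => _ //; rewrite add0r.
rewrite bigA_distr [RHS](bigID (fun E : {set T} => E \subset D)) /=.
rewrite [X in _ = _ + X]big1 ?addr0.
  apply: eq_bigr => E ED; rewrite big_mkcond; apply: eq_bigr => e _.
  by have [eE|eE] := boolP (e \in E); rewrite ?(subsetP ED _ eE).
by move=> E /subsetPn[e eE eD]; rewrite (bigD1 e) //= eE (negPf eD) mul0r.
Qed.

Lemma prod_subset_const D P (x : R) : P \subset D ->
  \prod_(e in D) (if e \in P then x else 1) = x ^+ #|P|.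
Proof.
move=> PD; rewrite -big_mkcondr /= -prodr_const; apply: eq_bigl => e.
by have [eP|] := boolP (e \in P); rewrite ?andbT ?andbF ?(subsetP PD _ eP).
Qed.

End SubsetSums.

(** * The random graph: independence, union bound, coupling, Chernoff bound *)

Section Gnp.
Variables (R : realType) (n : nat).
Implicit Types (p : R) (A B : pred {set {set 'I_n}}) (W : {set 'I_n}).
Local Notation D := (complete_edges n).

Lemma gnp_weight_ge0 p (E : {set {set 'I_n}}) :
  0 <= p <= 1 -> 0 <= gnp_weight p E.
Proof.
case/andP=> p0 p1; apply: prodr_ge0 => e _; case: ifP => _ //.
by rewrite subr_ge0.
Qed.

(** Independence of the edges, in the form used for both exponential moments below. *)
Lemma gnp_expect_prod p (F G : {set 'I_n} -> R) :
  \sum_(E : {set {set 'I_n}} | E \subset D)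
     gnp_weight p E * \prod_(e in D) (if e \in E then F e else G e) =
  \prod_(e in D) (p * F e + (1 - p) * G e).
Proof.
rewrite -sum_subset_prod; apply: eq_bigr => E ED; rewrite -big_split /=.
by apply: eq_bigr => e _; case: ifP.
Qed.

Lemma gnp_probC p A : gnp_prob p A = 1 - gnp_prob p (predC A).
Proof.
apply/eqP; rewrite eq_sym subr_eq; apply/eqP.
transitivity (\sum_(E : {set {set 'I_n}} | E \subset D) gnp_weight p E).
  rewrite sum_subset_prod big1 // => e _.
  by rewrite addrC subrK.
by rewrite (bigID A).
Qed.

Lemma gnp_prob_ge0 p A : 0 <= p <= 1 -> 0 <= gnp_prob p A.
Proof. by move=> p01; apply: sumr_ge0 => E _; apply: gnp_weight_ge0. Qed.

Lemma gnp_prob_le1 p A : 0 <= p <= 1 -> gnp_prob p A <= 1.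
Proof. by move=> p01; rewrite gnp_probC gerBl gnp_prob_ge0. Qed.

Lemma gnp_prob_markov p A (f : {set {set 'I_n}} -> R) : 0 <= p <= 1 ->
  (forall E, 0 <= f E) -> (forall E : {set {set 'I_n}}, E \subset D -> A E -> 1 <= f E) ->
  gnp_prob p A <=
    \sum_(E : {set {set 'I_n}} | E \subset D) gnp_weight p E * f E.
Proof.
move=> p01 f0 f1; rewrite [leRHS](bigID A) /= -[leLHS]addr0 lerD //.
  apply: ler_sum => E /andP[ED AE].
  by rewrite ler_peMr ?f1 ?gnp_weight_ge0.
by apply: sumr_ge0 => E _; rewrite mulr_ge0 ?gnp_weight_ge0.
Qed.

Lemma gnp_prob_le p A B : 0 <= p <= 1 ->
  (forall E : {set {set 'I_n}}, E \subset D -> A E -> B E) -> gnp_prob p A <= gnp_prob p B.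
Proof.
move=> p01 AB; rewrite /gnp_prob [leRHS]big_mkcond [leLHS]big_mkcond /=.
apply: ler_sum => E _; have [ED|//] := boolP (E \subset D) => /=.
have [/(AB _ ED)->//|_] := boolP (A E).
by case: ifP => // _; apply: gnp_weight_ge0.
Qed.

Lemma gnp_prob_bigcup p (I : finType) (P : pred I)
    (Q : I -> pred {set {set 'I_n}}) : 0 <= p <= 1 ->
  gnp_prob p (fun E => [exists i, P i && Q i E]) <=
    \sum_(i | P i) gnp_prob p (Q i).
Proof.
move=> p01.
apply: (@le_trans _ _ (\sum_(E : {set {set 'I_n}} | E \subset D)
    gnp_weight p E * \sum_(i | P i) (Q i E)%:R)).
  apply: gnp_prob_markov => // E; first by apply: sumr_ge0.
  move=> _ /existsP[i /andP[Pi QiE]]; rewrite (bigD1 i) //= QiE lerDl.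
  by apply: sumr_ge0.
under eq_bigr do rewrite mulr_sumr.
rewrite exchange_big /=; apply: ler_sum => i _.
rewrite /gnp_prob big_mkcondr /=; apply: ler_sum => E _.
by case: (Q i E); rewrite ?mulr1 ?mulr0.
Qed.

Lemma gnp_probU p A B : 0 <= p <= 1 ->
  gnp_prob p (fun E => A E || B E) <= gnp_prob p A + gnp_prob p B.
Proof.
move=> p01; pose Q (b : bool) := if b then A else B.
have := @gnp_prob_bigcup p bool xpredT Q p01.
rewrite big_bool; apply: le_trans; apply: gnp_prob_le => // E _.
by case/orP=> h; apply/existsP; [exists true|exists false].
Qed.

(* G(n,p) is obtained from G(n,p') by keeping each edge with probability p/p'. *)
Lemma gnp_prob_mono p p' A : 0 <= p -> p <= p' -> p' <= 1 ->
  (forall E E' : {set {set 'I_n}}, E \subset E' -> A E -> A E') ->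
  gnp_prob p A <= gnp_prob p' A.
Proof.
move=> p0 pp' p'1 mA.
have p'0 : 0 <= p' by exact: le_trans pp'.
have [q /andP[q0 q1] pq] : exists2 q, 0 <= q <= 1 & p = p' * q.
  have [p'E|p'E] := eqVneq p' 0.
    by exists 0; rewrite ?lexx ?ler01 // mulr0; apply: le_anti; rewrite p0 -p'E pp'.
  exists (p / p'); last by rewrite mulrC divfK.
  by rewrite divr_ge0 //= ler_pdivrMr ?mul1r // lt0r p'E.
(* The joint weight of the coupling: [E'] follows G(n,p') and each of its edges is kept in [E] with
   probability [q]. [KE] and [KE'] compute the two marginals. *)
pose K (E E' : {set {set 'I_n}}) := \prod_(e in D)
  (if e \in E' then (if e \in E then p' * q else p' * (1 - q))
   else (if e \in E then 0 else 1 - p')).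
have K0 E E' : 0 <= K E E'.
  apply: prodr_ge0 => e _; do 2?case: ifP => _ //;
    by rewrite ?mulr_ge0 ?subr_ge0.
have Kin (E E' : {set {set 'I_n}}) :
    E \subset D -> ~~ (E \subset E') -> K E E' = 0.
  move=> ED /subsetPn[e eE eE']; rewrite /K (bigD1 e) ?(subsetP ED) //=.
  by rewrite (negPf eE') eE mul0r.
have KE E : gnp_weight p E = \sum_(E' : {set {set 'I_n}} | E' \subset D) K E E'.
  rewrite sum_subset_prod; apply: eq_bigr => e _.
  by case: ifP => _; rewrite ?addr0 ?pq //; ring.
have KE' E' :
    gnp_weight p' E' = \sum_(E : {set {set 'I_n}} | E \subset D) K E E'.
  transitivity (\sum_(E : {set {set 'I_n}} | E \subset D) \prod_(e in D)
     (if e \in E then (if e \in E' then p' * q else 0)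
      else (if e \in E' then p' * (1 - q) else 1 - p'))).
    rewrite sum_subset_prod; apply: eq_bigr => e _.
    by case: ifP => _; rewrite ?add0r //; ring.
  by apply: eq_bigr => E _; apply: eq_bigr => e _; do 2!case: ifP.
rewrite /gnp_prob !big_mkcondr /=.
under eq_bigr do rewrite KE.
under [leRHS]eq_bigr do rewrite KE'.
apply: (@le_trans _ _ (\sum_(E : {set {set 'I_n}} | E \subset D)
   \sum_(E' : {set {set 'I_n}} | E' \subset D) (if A E' then K E E' else 0))).
  apply: ler_sum => E ED; case: ifP => AE.
    apply: ler_sum => E' _; case: ifP => // /negP nA.
    by rewrite Kin //; apply/negP => /mA/(_ AE).
  by apply: sumr_ge0 => E' _; case: ifP.
rewrite exchange_big /=; apply: ler_sum => E' _.
by case: ifP => _ //; rewrite big1.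
Qed.

(** Chernoff's method for the lower tail: Markov's inequality for [s ^+ #|E| / s ^+ m], which is at
    least 1 when [#|E| <= m] because [s <= 1]. *)
Lemma gnp_prob_few_edges p s m : 0 <= p <= 1 -> 0 < s <= 1 ->
  gnp_prob p (fun E : {set {set 'I_n}} => (#|E| <= m)%N) <=
    (1 - p * (1 - s)) ^+ 'C(n, 2) / s ^+ m.
Proof.
move=> p01 /andP[s0 s1].
apply: (@le_trans _ _ (\sum_(E : {set {set 'I_n}} | E \subset D)
   gnp_weight p E * (s ^- m * \prod_(e in D) (if e \in E then s else 1)))).
  apply: gnp_prob_markov => // E.
    rewrite mulr_ge0 ?invr_ge0 ?exprn_ge0 ?(ltW s0) //.
    by apply: prodr_ge0 => e _; case: ifP => _ //; apply: ltW.
  move=> ED Em; rewrite prod_subset_const // mulrC ler_pdivlMr ?exprn_gt0 //.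
  by rewrite mul1r ler_wiXn2l // ltW.
under eq_bigr do rewrite mulrCA.
rewrite -mulr_sumr (gnp_expect_prod p (fun=> s) (fun=> 1)) prodr_const.
rewrite mulrC /complete_edges card_vpairs cardsT card_ord.
by rewrite (_ : p * s + (1 - p) * 1 = 1 - p * (1 - s)) //; ring.
Qed.

End Gnp.

(** * The probability that a given vertex set is a rigid component *)

Section FirstMoment.
Variables (R : realType) (n : nat).
Implicit Types (p : R) (W : {set 'I_n}).
Local Notation D := (complete_edges n).

Definition cross_edges W : {set {set 'I_n}} :=
  [set [set u.1; u.2] | u in setX (~: W) W].

(** The cross edges prescribed by [phi], at most one per outside vertex; a vertex whose image lies
    outside [W] gets none. *)
Definition pattern W (phi : {ffun 'I_n -> 'I_n}) : {set {set 'I_n}} :=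
  [set [set u.1; u.2] | u in [set u in setX (~: W) W | phi u.1 == u.2]].

(* [phi v = v] encodes that [v] has no neighbour in [W]. *)
Definition attach W (v : 'I_n) : pred 'I_n :=
  [pred w | (w == v) || ((v \notin W) && (w \in W))].

Lemma cross_edge_inj W v w v' w' : v \notin W -> w \in W -> v' \notin W ->
  w' \in W -> [set v; w] = [set v'; w'] -> v = v' /\ w = w'.
Proof.
move=> vW wW v'W w'W e.
have : v \in [set v'; w'] by rewrite -e !inE eqxx.
have : w \in [set v'; w'] by rewrite -e !inE eqxx orbT.
rewrite !inE => /orP[/eqP wv'|/eqP->]; first by rewrite -wv' wW in v'W.
by case/orP=> /eqP // vw'; rewrite vw' w'W in vW.
Qed.

Lemma mem_pattern W phi v w : v \notin W -> w \in W ->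
  ([set v; w] \in pattern W phi) = (phi v == w).
Proof.
move=> vW wW; apply/imsetP/idP => [[[v' w']]|/eqP pv].
  rewrite !inE /= => /andP[/andP[v'W w'W] /eqP pv'].
  by case/(cross_edge_inj vW wW v'W w'W) => -> ->; apply/eqP.
by exists (v, w); rewrite ?inE //= vW wW pv eqxx.
Qed.

Lemma cross_edges_sub W : cross_edges W \subset D.
Proof.
apply/subsetP => e /imsetP[[v w]]; rewrite !inE /= => /andP[vW wW] ->.
by rewrite subsetT cards2 /=; case: (eqVneq v w) => // vw; rewrite vw wW in vW.
Qed.

Lemma cross_edgesN W e : e \in cross_edges W -> e \notin vpairs W.
Proof.
case/imsetP=> [[v w]]; rewrite !inE /= => /andP[vW wW] ->.
rewrite negb_and; apply/orP; left; apply/subsetPn; exists v => //.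
by rewrite !inE eqxx.
Qed.

Lemma cross_edges_prod W (h : {set 'I_n} -> R) :
  \prod_(e in cross_edges W) h e =
  \prod_(v in ~: W) \prod_(w in W) h [set v; w].
Proof.
rewrite big_imset /=; last first.
  move=> [v w] [v' w']; rewrite !inE /= => /andP[vW wW] /andP[v'W w'W].
  by case/(cross_edge_inj vW wW v'W w'W) => -> ->.
rewrite pair_big /=; apply: eq_bigl => -[v w].
by rewrite !inE.
Qed.

(** The total weight of [v] having at most one neighbour in [W]: with [k = #|W|], no neighbour
    weighs [q ^+ k], and each of the [k] single neighbours weighs [p * q ^+ k.-1]. *)
Lemma attach_sum W (p q : R) (v : 'I_n) : v \notin W -> (0 < #|W|)%N ->
  \sum_(w | attach W v w) \prod_(u in W) (if w == u then p else q) =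
  q ^+ #|W|.-1 * (q + #|W|%:R * p).
Proof.
move=> vW W0; rewrite (bigD1 v) /=; last by rewrite /attach /= eqxx.
have -> : \prod_(u in W) (if v == u then p else q) = q ^+ #|W|.
  rewrite -prodr_const; apply: eq_bigr => u uW.
  by case: eqVneq => // vu; rewrite vu uW in vW.
rewrite (eq_bigl (fun w => w \in W)); last first.
  move=> w; rewrite /attach /= vW.
  by have [->|_] := eqVneq w v; rewrite ?andbF ?andbT //= (negPf vW).
rewrite (eq_bigr (fun=> p * q ^+ #|W|.-1)); last first.
  move=> w wW; rewrite (bigD1 w) //= eqxx; congr (_ * _).
  rewrite (eq_bigr (fun=> q)); last first.
    by move=> u /andP[_]; rewrite eq_sym => /negPf->.
  have -> : #|W|.-1 = #|W :\ w| by rewrite (cardsD1 w W) wW.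
  by rewrite -prodr_const; apply: eq_bigl => u; rewrite !inE andbC.
rewrite sumr_const -[in q ^+ #|W|](prednK W0) exprSr -mulr_natl; ring.
Qed.

Lemma rigid_component_attach W (E : {set {set 'I_n}}) : E \subset D ->
  rigid_component E W -> exists2 phi : {ffun 'I_n -> 'I_n},
    phi \in family (attach W) & E :&: cross_edges W = pattern W phi.
Proof.
move=> ED cW.
(* An outside vertex has at most one neighbour in [W], so the picked one is the only one; the
   default [v] records that there is none. *)
exists [ffun v => if v \in W then v else
          odflt v [pick w in W | [set v; w] \in E]].
  apply/familyP => v; rewrite ffunE; case: ifP => vW; rewrite !inE ?eqxx //.
  by case: pickP => [w /andP[wW _]|_] /=; rewrite ?eqxx // vW wW orbT.
apply/setP => e; rewrite inE; apply/andP/idP => [[eE /imsetP[[v w]]]|eM].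
  rewrite !inE /= => /andP[vW wW] ee; subst e.
  rewrite mem_pattern // ffunE (negPf vW).
  case: pickP => [w' /andP[w'W e']|/(_ w)]; last by rewrite wW eE.
  by rewrite /= (rigid_component_nbr cW vW wW w'W eE e').
case/imsetP: eM => -[v w]; rewrite !inE /= => /andP[/andP[vW wW]] + ->.
rewrite ffunE (negPf vW); case: pickP => [w' /andP[w'W e'] /= /eqP<-|_ /= /eqP vw].
  by split=> //; apply/imsetP; exists (v, w'); rewrite ?inE /= ?vW ?w'W.
by rewrite vw wW in vW.
Qed.

(** Markov's inequality for [t] to the power of the excess of edges inside [W] over [2 * #|W| - 3],
    times the number of [phi] whose pattern is the set of cross edges present. Independence then
    gives one factor per pair inside [W] and one per outside vertex. *)
Lemma rigid_component_prob p t W : 0 <= p <= 1 -> 1 <= t ->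
  gnp_prob p (fun E : {set {set 'I_n}} => rigid_component E W) <=
    (1 + p * (t - 1)) ^+ 'C(#|W|, 2) / t ^+ (2 * #|W| - 3) *
    ((1 - p) ^+ #|W|.-1 * (1 - p + #|W|%:R * p)) ^+ (n - #|W|).
Proof.
move=> p01 t1; have t0 : 0 < t by exact: lt_le_trans t1.
have [W0|W0] := leqP #|W| 0.
  have WE : W = set0 by apply/eqP; rewrite -cards_eq0 -leqn0.
  have [p0 p1] := andP p01; rewrite /gnp_prob big1.
    have k0 : 0 <= #|W|%:R * p by rewrite mulr_ge0.
    have h1 : 0 <= 1 + p * (t - 1) by rewrite addr_ge0 ?mulr_ge0 ?subr_ge0.
    have h2 : 0 <= 1 - p by rewrite subr_ge0.
    apply: mulr_ge0; last by apply/exprn_ge0/mulr_ge0;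
      [exact: exprn_ge0 | exact: addr_ge0].
    by apply: divr_ge0; apply: exprn_ge0 => //; exact: ltW.
  move=> E /andP[_ /rigid_component_block/blockP[]].
  by rewrite WE cards0.
pose C := cross_edges W; pose M := pattern W.
(* [a] and [b] are the factors of a present and an absent edge: the tilt [t] inside [W], and on
   cross edges the indicator of agreement with the pattern of [phi]. *)
pose a phi (e : {set 'I_n}) : R :=
  (if e \in vpairs W then t else 1) *
  (if e \in C then (e \in M phi)%:R else 1).
pose b phi (e : {set 'I_n}) : R :=
  if e \in C then (e \notin M phi)%:R else 1.
have ab0 phi (E : {set {set 'I_n}}) e :
    0 <= (if e \in E then a phi e else b phi e) :> R.
  rewrite /a /b; case: ifP => _; last by case: ifP.
  by rewrite mulr_ge0 //; case: ifP => // _; apply: ltW.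
pose f (E : {set {set 'I_n}}) : R := t ^- (2 * #|W| - 3) *
  \sum_(phi in family (attach W))
    \prod_(e in D) (if e \in E then a phi e else b phi e).
apply: (@le_trans _ _ (\sum_(E : {set {set 'I_n}} | E \subset D)
   gnp_weight p E * f E)).
  apply: gnp_prob_markov => // E.
    rewrite mulr_ge0 ?invr_ge0 ?exprn_ge0 ?(ltW t0) // sumr_ge0 // => phi _.
    exact: prodr_ge0.
  move=> ED cW; have [phi phiF EC] := rigid_component_attach ED cW.
  rewrite /f mulrC ler_pdivlMr ?exprn_gt0 // mul1r.
  rewrite (bigD1 phi) //=.
  apply: (@le_trans _ _ (\prod_(e in D) (if e \in E then a phi e else b phi e)));
    last first.
    rewrite lerDl; apply: sumr_ge0 => psi _; exact: prodr_ge0.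
  rewrite (eq_bigr (fun e => if e \in induced_edges E W then t else 1)).
    rewrite prod_subset_const.
      by rewrite ler_weXn2l // block_induced_edges // rigid_component_block.
    by apply: (subset_trans _ ED); apply/subsetP => e; rewrite inE => /andP[].
  move=> e eD; rewrite /a /b /M -EC.
  have eM : (e \in vpairs W) = (e \subset W).
    by move: eD; rewrite !inE => /andP[_ ->]; rewrite andbT.
  rewrite eM in_setI -/C inE; case: (e \in E) => /=;
    by case: (e \in C) => //=; rewrite ?mulr1.
have -> : \sum_(E : {set {set 'I_n}} | E \subset D) gnp_weight p E * f E =
    t ^- (2 * #|W| - 3) * \sum_(phi in family (attach W))
      \prod_(e in D) (p * a phi e + (1 - p) * b phi e).
  under eq_bigr do rewrite mulrCA mulr_sumr.
  rewrite -mulr_sumr exchange_big /=; congr (_ * _).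
  by apply: eq_bigr => phi _; apply: gnp_expect_prod.
have -> : \sum_(phi in family (attach W))
    \prod_(e in D) (p * a phi e + (1 - p) * b phi e) =
  (1 + p * (t - 1)) ^+ 'C(#|W|, 2) *
  \sum_(phi in family (attach W)) \prod_v
    (if v \in W then 1 else \prod_(w in W) (if phi v == w then p else 1 - p)).
  rewrite mulr_sumr; apply: eq_bigr => phi _.
  transitivity (\prod_(e in D) ((if e \in vpairs W then 1 + p * (t - 1) else 1) *
      (if e \in C then (if e \in M phi then p else 1 - p) else 1))).
    apply: eq_bigr => e _; rewrite /a /b.
    have [eC|eC] := boolP (e \in C).
      by rewrite (negPf (cross_edgesN eC)); case: (e \in M phi) => /=; ring.
    by case: ifP => _; ring.
  rewrite big_split /= prod_subset_const ?card_vpairs; last first.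
    apply/subsetP => e; rewrite !inE => /andP[_ ->].
    by rewrite subsetT.
  congr (_ * _); rewrite -big_mkcondr /=.
  rewrite (eq_bigl (fun e => e \in C)); last first.
    move=> e; have [eC|] := boolP (e \in C); rewrite ?andbF ?andbT //=.
    by rewrite (subsetP (cross_edges_sub W)).
  rewrite cross_edges_prod big_mkcond /=; apply: eq_bigr => v _; rewrite inE.
  have [//|vW] := boolP (v \in W).
  by apply: eq_bigr => w wW; rewrite mem_pattern.
(* The sum over [phi] becomes a product over vertices of sums over their admissible images. A vertex
   of [W] admits only itself, with factor 1. *)
rewrite -(bigA_distr_big_dep (attach W) (fun v u => if v \in W then 1
  else \prod_(w in W) (if u == w then p else 1 - p))).
rewrite (bigID (fun v => v \in W)) /= big1 ?mul1r; last first.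
  move=> v vW; rewrite (big_pred1 v); first by rewrite vW.
  by move=> w; rewrite /attach /= vW orbF.
rewrite (eq_bigr (fun=> (1 - p) ^+ #|W|.-1 * (1 - p + #|W|%:R * p))); last first.
  by move=> v vW; rewrite -(attach_sum p _ vW) //; apply: eq_bigr => w _; rewrite (negPf vW).
rewrite (eq_bigl (fun v => v \in ~: W)); last by move=> v; rewrite /= inE.
have cWc : #|~: W| = (n - #|W|)%N by rewrite cardsCs setCK card_ord.
rewrite prodr_const cWc.
by rewrite mulrA [_ ^- _ * _]mulrC.
Qed.

Lemma rigid_component_card_prob p t k : 0 <= p <= 1 -> 1 <= t ->
  gnp_prob p (fun E : {set {set 'I_n}} =>
      [exists W : {set 'I_n}, (#|W| == k) && rigid_component E W]) <=
    'C(n, k)%:R * ((1 + p * (t - 1)) ^+ 'C(k, 2) / t ^+ (2 * k - 3) *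
    ((1 - p) ^+ k.-1 * (1 - p + k%:R * p)) ^+ (n - k)).
Proof.
move=> p01 t1; apply: le_trans (gnp_prob_bigcup _ _ p01) _.
rewrite -[X in 'C(X, k)]card_ord -card_draws mulr_natl -sumr_const.
rewrite [leRHS](eq_bigl (fun W : {set 'I_n} => #|W| == k)); last first.
  by move=> W; rewrite inE.
apply: ler_sum => W /eqP <-; exact: rigid_component_prob.
Qed.

End FirstMoment.

(** * Numerical inequalities for the exponential function *)

Section Estimates.
Variable R : realType.
Implicit Types (x y c : R).

Lemma expR_ge_sqr x : 0 <= x -> (x / 2) ^+ 2 <= expR x.
Proof.
move=> x0; have h := expR_ge1Dx (x / 2).
have -> : expR x = expR (x / 2) ^+ 2.
  by rewrite -expRM_natr; congr expR; field.
by rewrite lerXn2r ?nnegrE ?expR_ge0 //; lra.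
Qed.

(* [y * (6 + y) / (6 + 4 * y)] is the [2,1] Pade approximant of [ln (1 + y)]. *)
Lemma is_derive_pade x : -1 < x ->
  is_derive x (1 : R) (fun y : R => y * (6 + y) / (6 + 4 * y) - ln (1 + y))
    (4 * x ^+ 3 / ((6 + 4 * x) ^+ 2 * (1 + x))).
Proof.
move=> x1; have d0 : 6 + 4 * x != 0 by rewrite gt_eqF //; lra.
have l0 : 0 < 1 + x by lra.
have dl : is_derive (1 + x) (1 : R) (@ln R) (1 + x)^-1 by exact: is_derive1_ln.
have d1 : is_derive x (1 : R) (fun y : R => (6 + 4 * y)^-1)
    (- (6 + 4 * x) ^- 2 *: 4).
  apply: is_deriveV => //; apply: is_derive_eq.
  by rewrite /GRing.scale /=; ring.
apply: is_derive_eq.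
by rewrite /GRing.scale /=; field; rewrite d0 gt_eqF.
Qed.

Lemma derivable_pade x : -1 < x ->
  derivable (fun y : R => y * (6 + y) / (6 + 4 * y) - ln (1 + y)) x 1.
Proof. by move=> /is_derive_pade d; exact: ex_derive. Qed.

Lemma derive1_pade x : -1 < x ->
  derive1 (fun y : R => y * (6 + y) / (6 + 4 * y) - ln (1 + y)) x =
    4 * x ^+ 3 / ((6 + 4 * x) ^+ 2 * (1 + x)).
Proof. by move=> /is_derive_pade d; rewrite derive1E; apply: derive_val. Qed.

(** The approximant minus [ln (1 + x)] vanishes at 0 and its derivative has the sign of [x], so it
    is nonnegative. *)
Lemma expR_pade x : -1 < x -> 1 + x <= expR (x * (6 + x) / (6 + 4 * x)).
Proof.
move=> x1; have x1' : 0 < 1 + x by lra.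
rewrite -ler_ln ?posrE ?expR_gt0 // expRK -subr_ge0.
pose h := fun y : R => y * (6 + y) / (6 + 4 * y) - ln (1 + y).
have h0 : h 0 = 0 by rewrite /h mul0r mul0r addr0 ln1 subr0.
have cont y : -1 < y -> continuous_at y h.
  move=> /derivable_pade d; apply: differentiable_continuous.
  exact/derivable1_diffP.
rewrite -[X in _ <= X]/(h x) -h0; have [x0|x0] := leP 0 x.
- apply: (@ger0_derive1_ndecr _ h 0 x _ _ _ _ _ (lexx _) x0 (lexx _)).
  + by move=> y; rewrite in_itv /= => /andP[y0 _]; apply: derivable_pade; lra.
  + move=> y; rewrite in_itv /= => /andP[y0 _]; rewrite derive1_pade; last lra.
    rewrite divr_ge0 ?mulr_ge0 ?exprn_ge0 //; lra.
  + apply: continuous_in_subspaceT => y; rewrite classical_sets.inE /= in_itv /= => /andP[y0 _].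
    by apply: cont; lra.
- apply: (@ler0_derive1_nincr _ h x 0 _ _ _ _ _ (lexx _) (ltW x0) (lexx _)).
  + by move=> y; rewrite in_itv /= => /andP[y0 _]; apply: derivable_pade; lra.
  + move=> y; rewrite in_itv /= => /andP[y0 y1]; rewrite derive1_pade; last lra.
    rewrite mulr_le0_ge0 ?invr_ge0 ?mulr_ge0 ?exprn_ge0 //; try lra.
    by rewrite exprSr; nra.
  + apply: continuous_in_subspaceT => y; rewrite classical_sets.inE /= in_itv /= => /andP[y0 _].
    by apply: cont; lra.
Qed.

(* [10 = 2 ^+ 3 * (5 / 4)], with the Pade bound at [-1/2] and [-1/5]. *)
Lemma expR_tenth : 10^-1 <= expR (- (57 / 25) : R).
Proof.
have h2 : 2^-1 <= expR (- (11 / 16) : R).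
  have := @expR_pade (- 2^-1) ltac:(lra).
  have -> : - 2^-1 * (6 + - 2^-1) / (6 + 4 * - 2^-1) = - (11 / 16) :> R by field.
  by lra.
have h5 : 4 / 5 <= expR (- (29 / 130) : R).
  have := @expR_pade (- 5^-1) ltac:(lra).
  have -> : - 5^-1 * (6 + - 5^-1) / (6 + 4 * - 5^-1) = - (29 / 130) :> R by field.
  by lra.
apply: (@le_trans _ _ (expR (- (11 / 16) * 3%:R + (- (29 / 130))))); last first.
  by rewrite ler_expR; lra.
rewrite expRD expRM_natr; apply: (@le_trans _ _ ((2^-1) ^+ 3 * (4 / 5))); first by lra.
by rewrite ler_pM ?lerXn2r ?nnegrE ?expR_ge0 //; lra.
Qed.

(** The tangent of the logarithm at 1/10, the end of the range of [x], with [ln 10] lowered to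
    57/25; hence the constant 82/25 = 1 + 57/25. *)
Lemma le_expR_tangent x : x <= expR (10 * x - 82 / 25).
Proof.
rewrite (_ : _ - _ = (10 * x - 1) + (- (57 / 25))); last by field.
rewrite expRD; have := expR_ge1Dx (10 * x - 1); have := expR_tenth.
have := expR_gt0 (10 * x - 1); have := expR_gt0 (- (57 / 25) : R).
nra.
Qed.

(** The left side is an upper bound for F(x)/x: [ln x] is replaced by its tangent, and [ln (1 + z)]
    with [z = (c + 1) * x / (1 - x)] by its Pade approximant. *)
Lemma exponent_bound c x : 4 <= c <= 81 / 20 -> 0 <= x <= 10^-1 ->
  10 * x - 82 / 25 + (c + 1) * (6 + (c - 5) * x) / (6 + (4 * c - 2) * x)
    - c / 2 * (1 - x) <= - 20^-1.
Proof.
move=> /andP[c4 c5] /andP[x0 x1].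
have d0 : 0 < 6 + (4 * c - 2) * x by nra.
have : (c + 1) * (6 + (c - 5) * x) / (6 + (4 * c - 2) * x) <=
   c / 2 * (1 - x) + 82 / 25 - 10 * x - 20^-1; last by lra.
rewrite ler_pdivrMr //.
have c2 : 0 <= (c - 4) * (81 / 20 - c) by nra.
have x2 : 0 <= x * (10^-1 - x) by nra.
have h0 : 0 <= x * ((c - 4) * (81 / 20 - c)) by nra.
have h3 : 0 <= (c - 4) * (x * (10^-1 - x)) by nra.
have h4 : 0 <= (c - 4) * x by nra.
nra.
Qed.

End Estimates.

(** * Bounds on the expected number of components of size [k] *)

Section Asymptotics.
Variable R : realType.
Implicit Types (x p c : R) (n k : nat).

(** A single term of the expansion of [((1 - x) + x) ^+ n]. At [x = k / n] it is the entropy bound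
    on ['C(n, k)]. *)
Lemma binomial_term_le1 n k x : (k <= n)%N -> 0 <= x <= 1 ->
  'C(n, k)%:R * (x ^+ k * (1 - x) ^+ (n - k)) <= 1.
Proof.
move=> kn /andP[x0 x1]; have y0 : 0 <= 1 - x by rewrite subr_ge0.
have := exprDn (1 - x) x n; rewrite subrK expr1n => hE; rewrite [leRHS]hE.
have kn' : (k < n.+1)%N by [].
rewrite (bigD1 (Ordinal kn')) //= -[X in _ <= X + _]mulr_natl [x ^+ k * _]mulrC lerDl.
by apply: sumr_ge0 => i _; rewrite mulrn_wge0 // mulr_ge0 ?exprn_ge0.
Qed.

Lemma exprn_le_expR x y n : 0 <= x -> x <= expR y -> x ^+ n <= expR (y * n%:R).
Proof. by move=> x0 xy; rewrite expRM_natr lerXn2r ?nnegrE ?expR_ge0. Qed.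

(* The bound of [rigid_component_card_prob]; [t] is the tilting parameter. *)
Definition moment n k p (t : R) : R :=
  'C(n, k)%:R * ((1 + p * (t - 1)) ^+ 'C(k, 2) / t ^+ (2 * k - 3) *
    ((1 - p) ^+ k.-1 * (1 - p + k%:R * p)) ^+ (n - k)).

(** With [t = 1 / x], the tilt yields [x ^+ (2 * k - 3)] and the entropy bound costs [x ^- k],
    leaving [x ^+ (k - 3)]. The exponential comes from [p * (1 / x - 1) * k ^+ 2 / 2 = c / 2 * (1 -
    x) * k]. *)
Lemma moment_le c n k : 0 < c <= n%:R -> (3 <= k)%N -> (k < n)%N ->
  moment n k (c / n%:R) (n%:R / k%:R) <=
    expR (c / 2 * (1 - k%:R / n%:R) * k%:R) * (k%:R / n%:R) ^+ (k - 3) /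
      (1 - k%:R / n%:R) ^+ (n - k) *
    ((1 - c / n%:R) ^+ k.-1 * (1 - c / n%:R + k%:R * (c / n%:R))) ^+ (n - k).
Proof.
move=> /andP[c0 cn] k3 kn; set p := c / n%:R; set x := k%:R / n%:R.
have k0 : 0 < k%:R :> R by rewrite ltr0n (leq_trans _ k3).
have n0 : 0 < n%:R :> R by rewrite ltr0n (leq_trans _ kn).
have knR : k%:R < n%:R :> R by rewrite ltr_nat.
have x0 : 0 < x by rewrite divr_gt0.
have x1 : x < 1 by rewrite ltr_pdivrMr ?mul1r.
have p0 : 0 < p by rewrite divr_gt0.
have p1 : p <= 1 by rewrite ler_pdivrMr ?mul1r.
rewrite /moment mulrA; apply: ler_wpM2r.
  have q0 : 0 <= 1 - p by rewrite subr_ge0.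
  have kp0 : 0 <= k%:R * p by rewrite mulr_ge0 // ltW.
  by apply/exprn_ge0/mulr_ge0; [exact: exprn_ge0 | exact: addr_ge0].
have tE : n%:R / k%:R = x^-1 by rewrite invf_div.
have y0 : 0 < 1 - x by rewrite subr_gt0.
have hC : 'C(n, k)%:R <= (x ^+ k * (1 - x) ^+ (n - k))^-1.
  rewrite -[leRHS]mul1r ler_pdivlMr ?mulr_gt0 ?exprn_gt0 //.
  by rewrite binomial_term_le1 ?(ltnW kn) // !ltW.
have t1 : 0 <= x^-1 - 1 by rewrite subr_ge0 invf_ge1 // ltW.
have hE : (1 + p * (x^-1 - 1)) ^+ 'C(k, 2) <= expR (c / 2 * (1 - x) * k%:R).
  apply: le_trans (exprn_le_expR _ _ (expR_ge1Dx _)) _.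
    by rewrite addr_ge0 ?mulr_ge0 // ltW.
  have hb : 'C(k, 2)%:R <= k%:R ^+ 2 / 2 :> R.
    rewrite ler_pdivlMr ?ltr0n // -natrM -natrX ler_nat.
    by rewrite mulnC mul2n bin2 -[leqRHS]odd_double_half; clear; lia.
  rewrite ler_expR; apply: le_trans (ler_wpM2l _ hb) _.
    by rewrite mulr_ge0 // ltW.
  rewrite le_eqVlt; apply/orP; left; apply/eqP.
  by rewrite /p /x; field; rewrite !gt_eqF.
rewrite tE exprVn invrK.
have -> : expR (c / 2 * (1 - x) * k%:R) * x ^+ (k - 3) / (1 - x) ^+ (n - k) =
  (x ^+ k * (1 - x) ^+ (n - k))^-1 *
  (expR (c / 2 * (1 - x) * k%:R) * x ^+ (2 * k - 3)).
  have -> : (2 * k - 3 = (k - 3) + k)%N by clear -k3; lia.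
  have ar (a b e w : R) : a != 0 -> w != 0 ->
    e * b / w = (a * w)^-1 * (e * (b * a)).
    by move=> a0 w0; field; rewrite a0 w0.
  by rewrite exprD; apply: ar; rewrite expf_neq0 // gt_eqF.
apply: ler_pM => //.
  by apply: mulr_ge0; apply: exprn_ge0; rewrite ?(ltW x0) // addr_ge0 ?mulr_ge0 // ltW.
by apply: ler_wpM2r => //; rewrite exprn_ge0 ?(ltW x0).
Qed.

Lemma moment_small c n k : 0 < c <= n%:R -> (3 <= k)%N -> (k < n)%N ->
  moment n k (c / n%:R) (n%:R / k%:R) <=
    expR (1 + c / 2) ^+ k * (k%:R / n%:R) ^+ (k - 3).
Proof.
move=> hc k3 kn; apply: le_trans (moment_le hc k3 kn) _.
case/andP: hc => c0 cn.
have k0 : 0 < k%:R :> R by rewrite ltr0n (leq_trans _ k3).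
have n0 : 0 < n%:R :> R by rewrite ltr0n (leq_trans _ kn).
have knR : k%:R < n%:R :> R by rewrite ltr_nat.
set p := c / n%:R; set x := k%:R / n%:R.
have x0 : 0 < x by rewrite divr_gt0.
have x1 : x < 1 by rewrite ltr_pdivrMr ?mul1r.
have p0 : 0 < p by rewrite divr_gt0.
have p1 : p <= 1 by rewrite ler_pdivrMr ?mul1r.
have y0 : 0 < 1 - x by rewrite subr_gt0.
have hk : k%:R = k.-1%:R + 1 :> R by rewrite natr1 prednK // (leq_trans _ k3).
(* For small sizes the constraint on outside vertices is simply bounded by 1. *)
have hb : ((1 - p) ^+ k.-1 * (1 - p + k%:R * p)) ^+ (n - k) <= 1.
  have h0 : 0 <= 1 - p + k%:R * p.
    by apply: addr_ge0; rewrite ?subr_ge0 // mulr_ge0 // ltW.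
  apply: exprn_ile1; first by rewrite mulr_ge0 ?exprn_ge0 // subr_ge0.
  have h1 : (1 - p) ^+ k.-1 <= expR (- p * k.-1%:R).
    by apply: exprn_le_expR; [rewrite subr_ge0 | exact: expR_ge1Dx].
  have h2 : 1 - p + k%:R * p <= expR (k.-1%:R * p).
    by apply: le_trans (expR_ge1Dx _); rewrite hk; lra.
  apply: le_trans (ler_pM _ h0 h1 h2) _; first by rewrite exprn_ge0 // subr_ge0.
  by rewrite -expRD -[leRHS]expR0 ler_expR; lra.
(* This uses [1 / (1 - x) = 1 + x / (1 - x)] and [(n - k) * x / (1 - x) = k]. *)
have hy : ((1 - x) ^+ (n - k))^-1 <= expR k%:R.
  rewrite -exprVn.
  have -> : k%:R = x / (1 - x) * (n - k)%:R.
    by rewrite natrB 1?ltnW // /x; field; rewrite subr_eq0 !gt_eqF.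
  apply: exprn_le_expR; first by rewrite invr_ge0 ltW.
  by apply: le_trans (expR_ge1Dx _); rewrite le_eqVlt; apply/orP; left; apply/eqP;
    field; rewrite gt_eqF.
apply: le_trans (ler_wpM2l _ hb) _.
  by rewrite !mulr_ge0 ?expR_ge0 ?invr_ge0 ?exprn_ge0 // ltW.
rewrite mulr1 -mulrA mulrCA mulrC; apply: ler_wpM2r; first by rewrite exprn_ge0 // ltW.
apply: le_trans (ler_wpM2l (expR_ge0 _) hy) _.
rewrite -expRD -expRM_natr ler_expR.
have : 0 <= c * x * k%:R by rewrite !mulr_ge0 // ltW.
by lra.
Qed.

(** Here the constraint on outside vertices is kept: it turns the exponent [c / 2 * (1 - x) * k]
    into its negative, up to the constant [c]. *)
Lemma moment_large c n k : 4 <= c <= 81 / 20 -> c <= n%:R -> (3 <= k)%N ->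
  k%:R / n%:R <= 10^-1 :> R ->
  moment n k (c / n%:R) (n%:R / k%:R) <=
    expR c * (k%:R / n%:R) ^- 3 * expR (- (k%:R / 20)).
Proof.
move=> hc4 cn k3 x10; have [c4 c5] := andP hc4.
have c0 : 0 < c by lra.
have n0 : 0 < n%:R :> R by exact: lt_le_trans cn.
have k0 : 0 < k%:R :> R by rewrite ltr0n (leq_trans _ k3).
have knR : k%:R < n%:R :> R by move: x10; rewrite ler_pdivrMr //; lra.
have kn : (k < n)%N by rewrite -(ltr_nat R).
apply: le_trans (@moment_le c n k _ k3 kn) _; first by rewrite c0.
set p := c / n%:R; set x := k%:R / n%:R.
have x0 : 0 < x by rewrite divr_gt0.
have x1 : x < 1 by rewrite ltr_pdivrMr ?mul1r.
have p0 : 0 < p by rewrite divr_gt0.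
have p1 : p <= 1 by rewrite ler_pdivrMr ?mul1r.
have y0 : 0 < 1 - x by rewrite subr_gt0.
have hk : k.-1%:R = k%:R - 1 :> R by apply/eqP; rewrite eq_sym subr_eq natr1 prednK // (leq_trans _ k3).
have nkE : (n - k)%:R = n%:R * (1 - x) :> R.
  by rewrite natrB 1?ltnW // /x; field; rewrite gt_eqF.
set z := (c + 1) * x / (1 - x).
have hz : (1 + c * x) / (1 - x) = 1 + z by rewrite /z; field; rewrite gt_eqF.
have c1 : 0 < c + 1 by lra.
have z0 : 0 < z by rewrite /z divr_gt0 // mulr_gt0.
have c2 : 0 < 4 * c - 2 by lra.
have d0 : 0 < 6 + (4 * c - 2) * x by rewrite addr_gt0 // mulr_gt0.
(* Having [k.-1] rather than [k] in the exponent costs at most the factor [expR c]. *)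
have hb : ((1 - p) ^+ k.-1 * (1 - p + k%:R * p)) ^+ (n - k) <=
    expR (c - c * (1 - x) * k%:R) * (1 + c * x) ^+ (n - k).
  rewrite exprMn; apply: ler_pM.
  - by rewrite !exprn_ge0 // subr_ge0.
  - by apply: exprn_ge0; apply: addr_ge0; rewrite ?subr_ge0 // mulr_ge0 // ltW.
  - rewrite -exprM; apply: le_trans (exprn_le_expR _ _ (expR_ge1Dx _)) _.
      by rewrite subr_ge0.
    rewrite ler_expR natrM hk nkE.
    have -> : - p * ((k%:R - 1) * (n%:R * (1 - x))) =
        (c - c * (1 - x) * k%:R) - c * x.
      by rewrite /p; field; rewrite gt_eqF.
    by rewrite gerBl mulr_ge0 // ltW.
  - have -> : c * x = k%:R * p by rewrite /x /p mulrCA mulrA.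
    have kp0 : 0 <= k%:R * p by rewrite mulr_ge0 // ltW.
    by apply: lerXn2r; rewrite ?nnegrE; lra.
apply: le_trans (ler_wpM2l _ hb) _.
  by rewrite !mulr_ge0 ?expR_ge0 ?invr_ge0 ?exprn_ge0 // ltW.
(* Multiplying the Pade exponent by [n - k = n * (1 - x)] gives a multiple of [k = n * x]. *)
have hz2 : (1 + z) ^+ (n - k) <=
    expR ((c + 1) * (6 + (c - 5) * x) / (6 + (4 * c - 2) * x) * k%:R).
  have z1 : -1 < z by lra.
  apply: le_trans (exprn_le_expR _ _ (expR_pade z1)) _; first by lra.
  rewrite ler_expR nkE le_eqVlt; apply/orP; left; apply/eqP.
  have -> : k%:R = n%:R * x by rewrite /x mulrC divfK // gt_eqF.
  rewrite /z; field; rewrite !gt_eqF //=; nra.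
have hx : x ^+ k <= expR ((10 * x - 82 / 25) * k%:R).
  by apply: exprn_le_expR (le_expR_tangent x); rewrite ltW.
have -> : expR (c / 2 * (1 - x) * k%:R) * x ^+ (k - 3) / (1 - x) ^+ (n - k) *
    (expR (c - c * (1 - x) * k%:R) * (1 + c * x) ^+ (n - k)) =
  (expR c * x ^- 3) * (expR (- (c / 2 * (1 - x) * k%:R)) * (x ^+ k * (1 + z) ^+ (n - k))).
  have -> : expR (- (c / 2 * (1 - x) * k%:R)) = expR (c / 2 * (1 - x) * k%:R) *
      expR (c - c * (1 - x) * k%:R) * (expR c)^-1.
    by rewrite -expRN -!expRD; congr expR; field.
  rewrite -hz (expr_div_n (1 + c * x)) -[in x ^+ k](subnK k3) exprD.
  have : x ^+ 3 != 0 by rewrite expf_neq0 // gt_eqF.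
  have : (1 - x) ^+ (n - k) != 0 by rewrite expf_neq0 // gt_eqF.
  have : expR c != 0 by rewrite gt_eqF ?expR_gt0.
  move: (x ^+ 3) (x ^+ (k - 3)) ((1 - x) ^+ (n - k)) ((1 + c * x) ^+ (n - k))
    (expR c) (expR (c / 2 * (1 - x) * k%:R)) (expR (c - c * (1 - x) * k%:R)).
  by move=> a b w v e f g e0 w0 a0; field; rewrite a0 w0 e0.
apply: ler_wpM2l; first by rewrite mulr_ge0 ?expR_ge0 ?invr_ge0 ?exprn_ge0 // ltW.
apply: le_trans (ler_wpM2l (expR_ge0 _) (ler_pM _ _ hx hz2)) _.
- by rewrite exprn_ge0 // ltW.
- by rewrite exprn_ge0 //; lra.
rewrite -!expRD ler_expR.
have := @exponent_bound R c x hc4; rewrite (ltW x0) x10 => /(_ isT).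
by move/(ler_wpM2r (ltW k0)); lra.
Qed.

End Asymptotics.

(** * Summation over sizes, the edge count, and passage to the limit *)

Section Tails.
Variable R : realType.
Implicit Types (x p c alpha K : R) (n k : nat).

Lemma sum_half_powers n : \sum_(k < n) (k%:R / 2 ^+ k : R) <= 2.
Proof.
have -> : \sum_(k < n) (k%:R / 2 ^+ k : R) = 2 - 2 * (n%:R + 1) / 2 ^+ n.
  elim: n => [|n IH]; first by rewrite big_ord0 expr0; field.
  rewrite big_ord_recr /= IH exprS -natr1; field.
  by rewrite expf_neq0.
by rewrite gerBl divr_ge0 ?exprn_ge0 // mulr_ge0 // addr_ge0.
Qed.

(** The tilt [n / k] is admissible, being at least 1 for [k <= n]. *)
Lemma gnp_prob_component_cards n p (P : pred nat) : 0 < p <= 1 -> (0 < n)%N ->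
  gnp_prob p (fun E : {set {set 'I_n}} =>
      [exists W : {set 'I_n}, rigid_component E W && P #|W|]) <=
    \sum_(k < n.+1 | P k && (2 <= k)%N) moment n k p (n%:R / k%:R).
Proof.
move=> /andP[p0 p1] n0; have p01 : 0 <= p <= 1 by rewrite ltW.
apply: (@le_trans _ _ (\sum_(k < n.+1 | P k && (2 <= k)%N) gnp_prob p
   (fun E : {set {set 'I_n}} =>
      [exists W : {set 'I_n}, (#|W| == k) && rigid_component E W]))).
  apply: le_trans (gnp_prob_bigcup _ _ p01).
  apply: gnp_prob_le => // E _ /existsP[W /andP[cW PW]].
  have Wn : (#|W| < n.+1)%N by rewrite ltnS -[leqRHS]card_ord max_card.
  apply/existsP; exists (Ordinal Wn) => /=; rewrite PW /=.
  have /andP[-> _] := rigid_component_block cW.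
  by apply/existsP; exists W; rewrite eqxx.
apply: ler_sum => k /andP[_ k2]; apply: rigid_component_card_prob => //.
by rewrite ler_pdivlMr ?ltr0n ?(leq_trans _ k2) // mul1r ler_nat -ltnS.
Qed.

Lemma small_components c alpha n : 0 < c <= n%:R ->
  alpha < 1 -> expR (1 + c / 2) * alpha <= 2^-1 ->
  gnp_prob (c / n%:R) (fun E : {set {set 'I_n}} =>
      [exists W : {set 'I_n}, rigid_component E W &&
        ((4 <= #|W|)%N && (#|W|%:R < alpha * n%:R))]) <=
    32 * expR (1 + c / 2) ^+ 4 / n%:R.
Proof.
move=> hc a1 ha; have [c0 cn] := andP hc.
have n0 : 0 < n%:R :> R by exact: lt_le_trans cn.
set B := expR (1 + c / 2) in ha *; have B0 : 0 < B by exact: expR_gt0.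
apply: le_trans (gnp_prob_component_cards
  (fun k => (4 <= k)%N && (k%:R < alpha * n%:R)) _ _) _.
- by rewrite divr_gt0 //= ler_pdivrMr ?mul1r.
- by rewrite -(ltr0n R).
apply: (@le_trans _ _ (\sum_(k < n.+1) 16 * B ^+ 4 / n%:R * (k%:R / 2 ^+ k))).
  rewrite [leRHS](bigID (fun k : 'I_n.+1 =>
     ((4 <= k)%N && (k%:R < alpha * n%:R)) && (2 <= k)%N)) /= -[leLHS]addr0.
  have nonneg (k : 'I_n.+1) : 0 <= 16 * B ^+ 4 / n%:R * (k%:R / 2 ^+ k).
    by rewrite !mulr_ge0 ?invr_ge0 ?exprn_ge0 // ltW.
  apply: lerD; last by apply: sumr_ge0 => k _; exact: nonneg.
  apply: ler_sum => k /andP[/andP[k4 ka] _].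
  have k0 : 0 < k%:R :> R by rewrite ltr0n (leq_trans _ k4).
  have kn : (k < n)%N.
    rewrite -(ltr_nat R); apply: (lt_le_trans ka).
    by rewrite ler_piMl ?(ltW n0) // ltW.
  apply: le_trans (moment_small hc _ kn) _; first exact: ltnW.
  set x := k%:R / n%:R; have x0 : 0 < x by rewrite divr_gt0.
  have Bx : B * x <= 2^-1.
    by apply: le_trans ha; rewrite ler_wpM2l ?(ltW B0) // ler_pdivrMr // ltW.
  (* Since [k >= 4], a factor [B ^+ 4 * x] splits off: its [x = k / n] supplies the decay in [n],
     and the rest is [(B * x) ^+ j <= 2 ^- j]. The constant 16 is [2 ^+ 4]. *)
  have [j kj] : exists j, k = (j + 4)%N :> nat by exists (k - 4)%N; rewrite subnK.
  have -> : 16 * B ^+ 4 / n%:R * (k%:R / 2 ^+ k) = B ^+ 4 * x * 2^-1 ^+ j.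
    rewrite /x kj exprD exprVn; field; rewrite ?gt_eqF ?exprn_gt0 //.
  have -> : B ^+ k * x ^+ (k - 3) = B ^+ 4 * x * (B * x) ^+ j.
    have -> : (k - 3 = j.+1)%N by rewrite kj -addnBA // addn1.
    by move: (B) (x) => b y; rewrite kj exprD exprMn [y ^+ _]exprS; ring.
  rewrite ler_wpM2l ?mulr_ge0 ?exprn_ge0 ?(ltW x0) ?(ltW B0) //.
  by rewrite lerXn2r ?nnegrE ?mulr_ge0 ?(ltW x0) ?(ltW B0).
rewrite -mulr_sumr; apply: le_trans (ler_wpM2l _ (sum_half_powers _)) _.
  by rewrite !mulr_ge0 ?invr_ge0 ?exprn_ge0 // ltW.
by rewrite le_eqVlt; apply/orP; left; apply/eqP; field; rewrite gt_eqF.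
Qed.

(** As [k >= alpha * n], the factor [x ^- 3] is bounded and the exponential decay beats [n ^- 2] by
    [expR_ge_sqr]. Summing over [n + 1 <= 2 * n] sizes leaves O(1/n). *)
Lemma medium_components c alpha n : 4 <= c <= 81 / 20 -> c <= n%:R ->
  0 < alpha ->
  gnp_prob (c / n%:R) (fun E : {set {set 'I_n}} =>
      [exists W : {set 'I_n}, rigid_component E W &&
        ((4 <= #|W|)%N && (alpha * n%:R <= #|W|%:R < (n%:R / 10 : R)))]) <=
    2 * (expR c / alpha ^+ 3 * (40 / alpha) ^+ 2) / n%:R.
Proof.
move=> hc4 cn a0; have [c4 c5] := andP hc4.
have c0 : 0 < c by lra.
have n0 : 0 < n%:R :> R by exact: lt_le_trans cn.
have n1 : 1 <= n%:R :> R by lra.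
apply: le_trans (gnp_prob_component_cards
  (fun k => (4 <= k)%N && (alpha * n%:R <= k%:R < (n%:R / 10 : R))) _ _) _.
- by rewrite divr_gt0 //= ler_pdivrMr ?mul1r.
- by rewrite -(ltr0n R).
pose M := expR c / alpha ^+ 3 * (40 / (alpha * n%:R)) ^+ 2.
have M0 : 0 <= M.
  by apply: mulr_ge0; rewrite ?sqr_ge0 // divr_ge0 ?expR_ge0 // exprn_ge0 // ltW.
apply: (@le_trans _ _ (\sum_(k < n.+1) M)); last first.
  rewrite sumr_const card_ord -[leLHS]mulr_natl -natr1.
  apply: (@le_trans _ _ (2 * n%:R * M)); first by rewrite ler_wpM2r //; lra.
  rewrite le_eqVlt; apply/orP; left; apply/eqP.
  by rewrite /M; field; rewrite !gt_eqF.
rewrite [leLHS]big_mkcond; apply: ler_sum => k _; case: ifP => // h.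
have /andP[/andP[k4 /andP[ak k10]] _] := h.
have k0 : 0 < k%:R :> R by rewrite ltr0n (leq_trans _ k4).
have ax : alpha <= k%:R / n%:R by rewrite ler_pdivlMr.
apply: le_trans (moment_large hc4 cn _ _) _; first exact: ltnW.
  by rewrite ler_pdivrMr // mulrC ltW.
rewrite /M -!mulrA ler_wpM2l ?expR_ge0 //; apply: ler_pM.
- by rewrite invr_ge0 exprn_ge0 // divr_ge0 // ltW.
- exact: expR_ge0.
- rewrite lef_pV2 ?posrE ?exprn_gt0 ?divr_gt0 //.
  by rewrite lerXn2r ?nnegrE ?divr_ge0 // ltW.
- rewrite expRN -[leRHS]invrK lef_pV2 ?posrE ?expR_gt0 //; last first.
    by rewrite invr_gt0 exprn_gt0 // divr_gt0 // mulr_gt0.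
  apply: le_trans (expR_ge_sqr _); last by rewrite divr_ge0 // ltW.
  rewrite -exprVn invf_div lerXn2r ?nnegrE ?divr_ge0 ?mulr_ge0 ?(ltW k0) ?(ltW a0) //.
  by move: ak; set u := alpha * _; set v := k%:R; lra.
Qed.

Lemma few_edges c : 4 < c -> exists K, forall n, c <= n%:R ->
  gnp_prob (c / n%:R) (fun E : {set {set 'I_n}} => (#|E| <= 2 * n)%N) <=
    K / n%:R.
Proof.
(* With [s = 1 - u], the Chernoff exponent per vertex is at most [u * (2 / (1 - u) - c / 2)] up to
   O(1/n), negative for [u < (c - 4) / c]. Half this threshold is taken, and [g] is the resulting
   decay rate. *)
move=> c4; pose u := (c - 4) / (2 * c); pose g := u * c * (c - 4) / (2 * (c + 4)).
have c0 : 0 < c by lra.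
have u0 : 0 < u by rewrite divr_gt0 ?mulr_gt0 ?mulr_gt0 ?subr_gt0.
have u1 : u < 1 by rewrite ltr_pdivrMr ?mulr_gt0 //; lra.
have g1 : 0 < c + 4 by lra.
have g0 : 0 < g by rewrite /g divr_gt0 ?(mulr_gt0 (mulr_gt0 u0 c0)) ?mulr_gt0 ?subr_gt0.
exists (expR (c * u / 2) / g) => n cn.
have n0 : 0 < n%:R :> R by lra.
have p01 : 0 <= c / n%:R <= 1 by rewrite divr_ge0 ?(ltW c0) //= ler_pdivrMr ?mul1r.
have s01 : 0 < 1 - u <= 1 by rewrite subr_gt0 u1 gerBl ltW.
apply: le_trans (gnp_prob_few_edges _ _ p01 s01) _.
have h1 : (1 - c / n%:R * (1 - (1 - u))) ^+ 'C(n, 2) <=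
    expR (- (c * u / 2 * (n%:R - 1))).
  have -> : 1 - (1 - u) = u by ring.
  apply: le_trans (exprn_le_expR _ _ (expR_ge1Dx _)) _.
    rewrite subr_ge0 mulr_ile1 ?(ltW u0) ?(ltW u1) //; by case/andP: p01.
  rewrite ler_expR.
  have -> : 'C(n, 2)%:R = n%:R * (n%:R - 1) / 2 :> R.
    have nn : (0 < n)%N by rewrite -(ltr0n R).
    rewrite -[n%:R - 1](_ : n.-1%:R = _); last first.
      by apply/eqP; rewrite eq_sym subr_eq natr1 prednK.
    apply/eqP; rewrite eq_sym (can2_eq (divfK _) (mulfK _)) ?pnatr_eq0 //.
    by rewrite -!natrM (bin_ffact n 2) ffactnS ffactn1.
  by rewrite le_eqVlt; apply/orP; left; apply/eqP; field; rewrite gt_eqF.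
have h2 : ((1 - u) ^+ (2 * n))^-1 <= expR (u / (1 - u) * (2 * n)%:R).
  rewrite -exprVn; apply: exprn_le_expR; first by rewrite invr_ge0 subr_ge0 ltW.
  apply: le_trans (expR_ge1Dx _); rewrite le_eqVlt; apply/orP; left; apply/eqP.
  by field; rewrite gt_eqF ?subr_gt0.
apply: le_trans (ler_pM _ _ h1 h2) _.
- by rewrite exprn_ge0 // subr_ge0 mulr_ile1 ?subr_ge0 ?gerBl //; lra.
- by rewrite invr_ge0 exprn_ge0 // subr_ge0 ltW.
rewrite -expRD.
have -> : - (c * u / 2 * (n%:R - 1)) + u / (1 - u) * (2 * n)%:R =
    c * u / 2 - g * n%:R.
  have hu : 1 - u = (c + 4) / (2 * c) by rewrite /u; field; rewrite gt_eqF.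
  by rewrite hu natrM /g; field; rewrite !gt_eqF //; lra.
rewrite expRD expRN -[leRHS]mulrA ler_wpM2l ?expR_ge0 // -invfM.
rewrite lef_pV2 ?posrE ?expR_gt0 ?(mulr_gt0 g0 n0) //.
by apply: le_trans (expR_ge1Dx _); lra.
Qed.

Lemma almost_surelyW c (A : forall n, pred {set {set 'I_n}}) K : 0 < c ->
  (forall n, c <= n%:R -> gnp_prob (c / n%:R) (predC (A n)) <= K / n%:R) ->
  almost_surely c A.
Proof.
move=> c0 hK; rewrite /almost_surely.
(* The factor 2 absorbs the shift in [harmonic n], which is [1 / (n + 1)]; the absolute value is
   there because the sign of [K] is unknown. *)
apply: (@squeeze_cvgr _ _ _ _ (fun n => 1 - 2 * `|K| * harmonic n) (fun=> 1)).
- near=> n.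
  have cn : c <= n%:R by near: n; exact: nbhs_infty_ger.
  have n0 : 0 < n%:R :> R by exact: lt_le_trans cn.
  have p01 : 0 <= c / n%:R <= 1 by rewrite divr_ge0 ?(ltW c0) //= ler_pdivrMr ?mul1r.
  rewrite gnp_prob_le1 // andbT gnp_probC lerB //.
  apply: le_trans (hK n cn) _.
  apply: (@le_trans _ _ (`|K| / n%:R)); first by rewrite ler_wpM2r ?invr_ge0 ?ler_norm ?ltW.
  rewrite [2 * _]mulrC -mulrA ler_wpM2l // /harmonic /= ler_pdivlMr ?ltr0n //.
  rewrite mulrC ler_pdivrMr // -natr1.
  by have : 1 <= n%:R :> R; [rewrite ler1n -(ltr0n R)|lra].
- have h : (2 * `|K| * harmonic n @[n --> \oo] --> 2 * `|K| * (0 : R))%classic.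
    by apply: cvgMr; exact: cvg_harmonic.
  rewrite -[X in (_ --> X)%classic](subr0 1) -[X in (_ --> _ - X)%classic](mulr0 (2 * `|K|)).
  by apply: cvgB => //; exact: cvg_cst.
- exact: cvg_cst.
Unshelve. all: by end_near.
Qed.

End Tails.

(** * Sizes of rigid components in the random graph *)

Theorem theorem1 (R : realType) (c : R) (hc : 0 < c) :
  (exists2 alpha : R, 0 < alpha &
     almost_surely c (fun (n : nat) (E : {set {set 'I_n}}) =>
       [forall W : {set 'I_n}, rigid_component E W ==>
          [|| #|W| == 2%N, #|W| == 3%N | alpha * n%:R <= #|W|%:R]]))
  /\
  (4 < c ->
     almost_surely c (fun (n : nat) (E : {set {set 'I_n}}) =>
       [exists W : {set 'I_n},
          rigid_component E W && (n%:R / 10 <= #|W|%:R :> R)])).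
Proof.
(* [alpha d] is chosen so that [B d * alpha d = 1 / 2], the ratio that [small_components] allows. *)
pose B d : R := expR (1 + d / 2); pose alpha d : R := (2 * B d)^-1.
have B1 d : 0 < d -> 1 < B d.
  by move=> d0; rewrite /B -[ltLHS]expR0 ltr_expR; lra.
have alpha0 d : 0 < alpha d by rewrite invr_gt0 mulr_gt0 ?expR_gt0.
have alpha1 d : 0 < d -> alpha d < 1.
  by move=> /B1 h; rewrite invf_lt1; lra.
have Balpha d : B d * alpha d <= 2^-1.
  by rewrite /alpha invfM mulrCA divff ?mulr1 // gt_eqF ?expR_gt0.
split=> [|c4].
  exists (alpha c); first exact: alpha0.
  apply: (@almost_surelyW _ _ _ (32 * B c ^+ 4)) => // n cn.
  have n0 : 0 < n%:R :> R by exact: lt_le_trans cn.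
  apply: le_trans (@small_components _ c (alpha c) n _ (alpha1 _ hc) (Balpha _));
    last by rewrite hc.
  apply: gnp_prob_le => [|E _].
    by rewrite divr_ge0 ?(ltW hc) //= ler_pdivrMr ?mul1r.
  rewrite /= negb_forall => /existsP[W]; rewrite negb_imply => /andP[cW].
  rewrite !negb_or -ltNge => /and3P[W2 W3 Wa].
  apply/existsP; exists W; rewrite cW Wa andbT /=.
  have /andP[W2' _] := rigid_component_block cW.
  by case: #|W| W2 W3 W2' => [|[|[|[|]]]].
pose d : R := Num.min c (81 / 20).
have d4 : 4 < d by rewrite lt_min c4; lra.
have d5 : d <= 81 / 20 by rewrite ge_min lexx orbT.
have dc : d <= c by rewrite ge_min lexx.
have d0 : 0 < d by lra.
have [K0 hK0] := few_edges d4.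
pose K := K0 + 32 * B d ^+ 4 + 2 * (expR d / alpha d ^+ 3 * (40 / alpha d) ^+ 2).
apply: (@almost_surelyW _ _ _ K) => // n cn.
have n0 : 0 < n%:R :> R by exact: lt_le_trans cn.
have dn : d <= n%:R by exact: le_trans cn.
have p01 : 0 <= d / n%:R <= 1 by rewrite divr_ge0 ?(ltW d0) //= ler_pdivrMr ?mul1r.
pose A := fun E : {set {set 'I_n}} => [exists W : {set 'I_n},
  rigid_component E W && (n%:R / 10 <= #|W|%:R :> R)].
(* Added edges may destroy the maximality of a component but not its rigidity; it stays a block and
   lies in a component at least as large. *)
have mono : gnp_prob (d / n%:R) A <= gnp_prob (c / n%:R) A.
  apply: gnp_prob_mono.
  - by case/andP: p01.
  - by rewrite ler_wpM2r ?invr_ge0 ?(ltW n0).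
  - by rewrite ler_pdivrMr ?mul1r.
  move=> E E' EE' /existsP[W /andP[cW Wn]].
  have [W' cW' WW'] := block_component (blockS EE' (rigid_component_block cW)).
  apply/existsP; exists W'; rewrite cW'; apply: le_trans Wn _.
  by rewrite ler_nat subset_leq_card.
apply: (@le_trans _ _ (gnp_prob (d / n%:R) (predC A))).
  by rewrite -lerN2 -(lerD2l 1) -!gnp_probC.
(* With more than [2 * n] edges and no large component, the component containing the dense block has
   at least 4 vertices and is small or medium. So failure implies one of three events, each of
   probability O(1/n). *)
apply: (@le_trans _ _ (gnp_prob (d / n%:R) (fun E : {set {set 'I_n}} =>
  (#|E| <= 2 * n)%N ||
  ([exists W : {set 'I_n}, rigid_component E W &&
        ((4 <= #|W|)%N && (#|W|%:R < alpha d * n%:R))] ||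
   [exists W : {set 'I_n}, rigid_component E W &&
        ((4 <= #|W|)%N && (alpha d * n%:R <= #|W|%:R < (n%:R / 10 : R)))])))).
  apply: gnp_prob_le => // E ED /= nA; have [//|mE /=] := leqP #|E| (2 * n)%N.
  have n2 : (2 <= n)%N by rewrite -(ler_nat R); lra.
  have [||W bW W4] := dense_block ED; rewrite ?card_ord //.
    by rewrite (leq_trans (leq_subr _ _)) // ltnW.
  have [W' cW' WW'] := block_component bW.
  have W4' : (4 <= #|W'|)%N by apply: leq_trans W4 _; exact: subset_leq_card.
  have [h|h] := ltP #|W'|%:R (alpha d * n%:R); apply/orP.
    by left; apply/existsP; exists W'; rewrite cW' W4' h.
  right; apply/existsP; exists W'; rewrite cW' W4' h /= ltNge.
  by apply: contra nA => h'; apply/existsP; exists W'; rewrite cW'.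
apply: le_trans (gnp_probU _ _ p01) _.
rewrite /K -addrA [leRHS]mulrDl; apply: lerD; first exact: hK0.
apply: le_trans (gnp_probU _ _ p01) _; rewrite [leRHS]mulrDl; apply: lerD.
  by apply: small_components; [rewrite d0 | exact: alpha1 | exact: Balpha].
by apply: medium_components => //; rewrite d5 ltW.
Qed.
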